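(* Let $\mathcal{D}\subseteq\mathbb{R}^n$ be a convex domain, let $\lambda>0$ and $\alpha\in(0,1)$, and let $\mathcal{Z}(x;\omega)=p(x,\omega)-q(x,\omega)$, where $p(\cdot,\omega)$ and $q(\cdot,\omega)$ are both convex functions on $\mathcal{D}$ for every fixed $\omega\in\Omega$. Write $\mathcal{Z}=\mathcal{Z}(x;\tilde\omega)$. Then the following hold, where $\tilde\omega$ is required to be discretely distributed for the results on $\mathrm{VaR}_\alpha(\mathcal{Z})$, $m_u(\mathcal{Z})$ and $\sigma(\mathcal{Z})$ (and hence for the risk measures below built from $\mathrm{VaR}_\alpha(\mathcal{Z})$ or $\sigma(\mathcal{Z})$), and is not required to be so otherwise. (i) All the expectation-based, CVaR-based and VaR-based risk measures $$\mathcal{R}_\lambda(x)=\mathbb{E}\,\mathcal{Z}(x;\tilde\omega)+\lambda\,\mathbf{D}[\mathcal{Z}(x;\tilde\omega)]$$ are dc functions of $x$ on $\mathcal{D}$. That is, $\mathcal{R}_\lambda$ is dc on $\mathcal{D}$ when the deviation measure $\mathbf{D}(\mathcal{Z})$ is any one of $$\mathbb{E}[\mathcal{Z}-B]^2,\qquad \sqrt{\mathbb{E}[\mathcal{Z}-B]^2},\qquad \mathbb{E}[\mathcal{Z}-B]_+,\qquad \mathbb{E}|\mathcal{Z}-B|,$$ with $B=\mathbb{E}\mathcal{Z}$, $B=\mathrm{CVaR}_\alpha(\mathcal{Z})$ or $B=\mathrm{VaR}_\alpha(\mathcal{Z})$, and also when $\mathbf{D}(\mathcal{Z})$ is itself $\mathrm{CVaR}_\alpha(\mathcal{Z})$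 or $\mathrm{VaR}_\alpha(\mathcal{Z})$. (ii) For a piecewise linear utility function $u$, the optimized certainty equivalent $\mathcal{O}_u(\mathcal{Z}(x;\tilde\omega))$ and the largest maximizer $m_u(\mathcal{Z}(x;\tilde\omega))$ are dc functions of $x$ on $\mathcal{D}$.
   Context: A function on a convex set is dc (difference-of-convex) if it is the difference of two convex functions on that set. $\tilde\omega$ is a random variable on a probability space $(\Omega,\mathcal{F},\mathbb{P})$ and $\mathbb{E}$ is the expectation with respect to it. ''Discretely distributed'' means that the sample space is finite, $\Omega=\{\omega^1,\dots,\omega^S\}$, with probabilities $p_1,\dots,p_S$. $\mathbb{E}[Y]^2$ denotes $\mathbb{E}[Y^2]$, $[\cdot]_+=\max(0,\cdot)$, and $\sigma(\mathcal{Z})=\sqrt{\mathbb{E}[\mathcal{Z}-\mathbb{E}\mathcal{Z}]^2}$ is the standard deviation. For a random variable $\mathcal{Z}$, $$\mathrm{CVaR}_\alpha(\mathcal{Z})=\min_{t\in\mathbb{R}}\Big[t+\frac{1}{1-\alpha}\mathbb{E}[\mathcal{Z}-t]_+\Big],\qquad \mathrm{VaR}_\alpha(\mathcal{Z})=\min\Big\{t' : t'\in\operatorname*{argmin}_{t\in\mathbb{R}}\Big[t+\frac{1}{1-\alpha}\mathbb{E}[\mathcal{Z}-t]_+\Big]\Big\}.$$ A utility function is a proper, concave, non-decreasing, lower semicontinuous function $u:\mathbb{R}\to[-\infty,\infty)$ with non-empty effective domain such that $u(0)=0$ and $1\in\partial u(0)$, where $\partial u$ is the subdifferential of the concave function $u$.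 A piecewise linear one has the form $u(t)=\min_{1\le i\le I}(a_it+\alpha_i)$ for a positive integer $I$ and scalars $a_i\ge 0$, $\alpha_i$. For an essentially bounded random variable $\mathcal{Z}$, $$\mathcal{O}_u(\mathcal{Z})=\sup_{\eta\in\mathbb{R}}\big[\eta+\mathbb{E}\,u(\mathcal{Z}-\eta)\big],\qquad m_u(\mathcal{Z})=\max\Big\{\eta' : \eta'\in\operatorname*{argmax}_{\eta\in\mathbb{R}}\big[\eta+\mathbb{E}\,u(\mathcal{Z}-\eta)\big]\Big\},$$ the latter being considered when the supremum is attained (as it is when the support of $\mathcal{Z}$ is a compact interval).
   Formalization: p(x,·) and q(x,·) are assumed integrable for x in D, and square-integrable for E[Z−B]^2 (otherwise E Z or E Z^2 need not be dc); sqrt(E[Z−CVaR]^2) is counted among the measures built from σ, so it too requires discretely distributed ω̃. *)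

(* Defs.v *)
From HB Require Import structures.
From mathcomp Require Import all_boot all_order all_algebra.
From mathcomp Require Import all_classical all_reals all_analysis.
Import Order.TTheory GRing.Theory Num.Theory numFieldNormedType.Exports.

Set Implicit Arguments.
Unset Strict Implicit.
Unset Printing Implicit Defensive.

Local Open Scope classical_set_scope.
Local Open Scope ring_scope.

Definition dc_on (R : realType) (n : nat) (D : set 'rV[R]_n)
    (f : 'rV[R]_n -> R) : Prop :=
  exists g h : 'rV[R]_n -> R,
    [/\ @convex_function R 'rV[R]_n D g, @convex_function R 'rV[R]_n D h &
        forall x, D x -> f x = g x - h x].

Definition is_minimum (R : realType) (A : set R) (m : R) : Prop :=
  A m /\ lbound A m.

Definition is_maximum (R : realType) (A : set R) (m : R) : Prop :=
  A m /\ ubound A m.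

(* The minimum (resp. maximum) of A; the value is 0 when A has none. *)
Definition minimum (R : realType) (A : set R) : R := xget 0 (is_minimum A).

Definition maximum (R : realType) (A : set R) : R := xget 0 (is_maximum A).

(* A finite sample space in which every outcome has a probability. Every
   real function on such a space is measurable and integrable. *)
Definition finite_discrete (d : measure_display) (T : measurableType d) : Prop :=
  finite_set [set: T] /\ forall w : T, measurable [set w].

Section RiskMeasures.
Context (d : measure_display) (T : measurableType d) (R : realType).
Variable P : probability T R.
Implicit Types (Z : T -> R) (alpha B lam t eta : R) (u : R -> \bar R).

(* Real-valued expectation; meaningful when Z is integrable. *)
Definition mean Z : R := fine 'E_P[Z].

Definition cvar_obj alpha Z t : R :=
  t + (1 - alpha)^-1 * mean (fun w => Num.max 0 (Z w - t)).

Definition CVaR alpha Z : R := minimum (range (cvar_obj alpha Z)).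

Definition VaR alpha Z : R :=
  minimum [set t' | forall t, cvar_obj alpha Z t' <= cvar_obj alpha Z t].

Definition sq_dev B Z : R := mean (fun w => (Z w - B) ^+ 2).

Definition root_dev B Z : R := Num.sqrt (mean (fun w => (Z w - B) ^+ 2)).

Definition plus_dev B Z : R := mean (fun w => Num.max 0 (Z w - B)).

Definition abs_dev B Z : R := mean (fun w => `|Z w - B|).

Definition risk lam (Dev : (T -> R) -> R) Z : R := mean Z + lam * Dev Z.

Definition oce_obj u Z eta : \bar R :=
  (eta%:E + \int[P]_w u (Z w - eta)%R)%E.

Definition OCE u Z : \bar R := ereal_sup (range (oce_obj u Z)).

Definition oce_argmax u Z : set R :=
  [set eta' | forall eta, (oce_obj u Z eta <= oce_obj u Z eta')%E].

Definition largest_maximizer u Z : R := maximum (oce_argmax u Z).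

End RiskMeasures.

(* s belongs to the subdifferential at t0 of the concave function u. *)
Definition concave_subgradient (R : realType) (u : R -> \bar R) (t0 s : R) :
    Prop :=
  forall t : R, (u t <= u t0 + (s * (t - t0))%:E)%E.

Definition utility (R : realType) (u : R -> \bar R) : Prop :=
  [/\ (forall t, u t < +oo)%E,
      (exists t, -oo < u t)%E,
      (forall r s t : R, 0 <= t <= 1 ->
        (t%:E * u r + (1 - t)%:E * u s <= u (t * r + (1 - t) * s)%R)%E),
      (forall r s : R, r <= s -> (u r <= u s)%E) &
      [/\ lower_semicontinuous u, u 0 = 0%E & concave_subgradient u 0 1]].

Definition piecewise_linear (R : realType) (u : R -> \bar R) : Prop :=
  exists (I : nat) (a c : 'I_I -> R),
    [/\ (0 < I)%N, (forall i, 0 <= a i) &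
        forall t, u t = \big[Order.min/+oo%E]_(i < I) (a i * t + c i)%:E].

(* Main.v *)
(*
Writing Z = p - q, each functional is made convex in x by adding convex terms.
For instance max(0, p - q - b1 + b2) = max(p + b2, q + b1) - (q + b1), while
p (sum of the slopes) - u(p - q - eta) is jointly convex in (x, eta), and so is
its expectation, whose partial infimum over eta gives the optimized certainty
equivalent. CVaR and VaR are, up to sign, the optimized certainty equivalent
and the largest maximizer of - Z for the utility t |-> min(0, t / (1 - alpha)).

Squares and products need nonnegative convex summands. For a convex set D in
R^n there are finitely many points v of D and one convex function N >= 0 such
that f(x) + N(x) (sum of the |f(v)|) >= 0 on D for every convex f. As the bound
is explicit in the values f(v), it is measurable and square integrable in omega
when it is applied to p(., omega) and q(., omega).

On a finite sample space, m_u(Z) <= eta holds if and only if the left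
derivatives satisfy E u'(Z - eta) > 1. This only depends on which of the
numbers Z(omega) - b, with b a breakpoint of u, lie below eta, so that m_u(Z)
is a minimum of maxima of these numbers.
*)
Require Import Defs.
From HB Require Import structures.
From mathcomp Require Import all_boot all_order all_algebra.
From mathcomp Require Import all_classical all_reals all_analysis.
From mathcomp Require Import measurable_realfun.
From mathcomp Require Import ring lra.
Import Order.TTheory GRing.Theory Num.Theory numFieldNormedType.Exports.

Set Implicit Arguments.
Unset Strict Implicit.
Unset Printing Implicit Defensive.

Local Open Scope classical_set_scope.
Local Open Scope ring_scope.

Section DCFunctions.
Context (R : realType) (n : nat).
Local Notation V := 'rV[R]_n.
Implicit Types (D : set V) (f g h F : V -> R) (x y : V) (t c : R).

Definition cvx D f := forall x y t, D x -> D y -> 0 <= t <= 1 ->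
  f (t *: x + (1 - t) *: y) <= t * f x + (1 - t) * f y.

Definition cvx_set D := forall x y t, D x -> D y -> 0 <= t <= 1 ->
  D (t *: x + (1 - t) *: y).

Lemma convex_setP D : @convex_set R V D <-> cvx_set D.
Proof.
split=> [cD x y t Dx Dy t01|cD x y t].
  have := cD x y (Itv01 (andP t01).1 (andP t01).2).
  by rewrite !inE; apply.
rewrite !inE => Dx Dy; apply: cD => //; exact/andP.
Qed.

Lemma convex_functionP D f : @convex_function R V D f <-> cvx D f.
Proof.
split=> [cf x y t Dx Dy t01|cf t x y].
  have := cf (Itv01 (andP t01).1 (andP t01).2) x y.
  by rewrite !inE; apply.
rewrite !inE => Dx Dy; apply: cf => //; exact/andP.
Qed.

Lemma dc_onP D f : dc_on D f <->
  exists g h, [/\ cvx D g, cvx D h & forall x, D x -> f x = g x - h x].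
Proof.
by split=> -[g [h [cg ch fE]]]; exists g, h; split=> //; apply/convex_functionP.
Qed.

Lemma cvx_cst D c : cvx D (fun=> c).
Proof. by move=> x y t _ _ _; rewrite -mulrDl subrKC mul1r. Qed.

Lemma cvxD D f g : cvx D f -> cvx D g -> cvx D (fun x => f x + g x).
Proof.
move=> cf cg x y t Dx Dy t01.
have := cf _ _ _ Dx Dy t01; have := cg _ _ _ Dx Dy t01; lra.
Qed.

Lemma cvxZ D c f : 0 <= c -> cvx D f -> cvx D (fun x => c * f x).
Proof.
move=> c0 cf x y t Dx Dy t01.
have := ler_wpM2l c0 (cf _ _ _ Dx Dy t01); lra.
Qed.

Lemma cvx_sum D (I : Type) (r : seq I) (p : pred I) (f : I -> V -> R) :
  (forall i, p i -> cvx D (f i)) -> cvx D (fun x => \sum_(i <- r | p i) f i x).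
Proof.
move=> cf; elim: r => [|i r IH].
  rewrite (_ : (fun _ => _) = fun=> 0); first exact: cvx_cst.
  by apply/funext => x; rewrite big_nil.
have [pi|pi] := boolP (p i); last first.
  rewrite (_ : (fun _ => _) = fun x => \sum_(i <- r | p i) f i x)//.
  by apply/funext => x; rewrite big_cons (negbTE pi).
rewrite (_ : (fun _ => _) = fun x => f i x + \sum_(i <- r | p i) f i x).
  by apply: cvxD => //; exact: cf.
by apply/funext => x; rewrite big_cons pi.
Qed.

Lemma cvx_sqr D f : cvx_set D -> (forall x, D x -> 0 <= f x) -> cvx D f ->
  cvx D (fun x => f x ^+ 2).
Proof.
move=> cD f0 cf x y t Dx Dy t01.
have h := cf _ _ _ Dx Dy t01.
apply: (@le_trans _ _ ((t * f x + (1 - t) * f y) ^+ 2)).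
  have fz : 0 <= f (t *: x + (1 - t) *: y) by apply: f0; exact: cD.
  by rewrite ler_sqr// nnegrE (le_trans fz).
have [t0 t1] := andP t01.
rewrite -subr_ge0 [leRHS](_ : _ = t * (1 - t) * (f x - f y) ^+ 2); last ring.
by rewrite mulr_ge0 ?sqr_ge0// mulr_ge0// subr_ge0.
Qed.

Lemma cvx_attained_sup D (I : Type) (A : set I) (f : I -> V -> R) F :
  cvx_set D -> (forall i, A i -> cvx D (f i)) ->
  (forall i x, A i -> D x -> f i x <= F x) ->
  (forall x, D x -> exists2 i, A i & F x = f i x) -> cvx D F.
Proof.
move=> cD cf fF Ff x y t Dx Dy /[dup] t01 /andP[t0 t1].
have [i Ai ->] := Ff _ (cD _ _ _ Dx Dy t01).
apply: (le_trans (cf _ Ai _ _ _ Dx Dy t01)).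
by rewrite lerD// ler_wpM2l ?subr_ge0// fF.
Qed.

Lemma cvx_max D f g : cvx_set D -> cvx D f -> cvx D g ->
  cvx D (fun x => Num.max (f x) (g x)).
Proof.
move=> cD cf cg.
apply: (@cvx_attained_sup D bool setT (fun b => if b then f else g)) => //.
- by case.
- by move=> [] x _ _; rewrite le_max lexx// orbT.
- move=> x _; have [_|_] := leP (f x) (g x); first by exists false.
  by exists true.
Qed.

Lemma cvx_inf D (G : V -> R -> R) :
  (forall x y a b t, D x -> D y -> 0 <= t <= 1 ->
    G (t *: x + (1 - t) *: y) (t * a + (1 - t) * b) <=
      t * G x a + (1 - t) * G y b) ->
  cvx_set D -> (forall x, D x -> has_lbound (range (G x))) ->
  cvx D (fun x => inf (range (G x))).
Proof.
move=> cG cD Glb x y t Dx Dy /[dup] t01 /andP[t0 t1].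
have has_infG z : D z -> has_inf (range (G z)).
  by move=> Dz; split; [exists (G z 0), 0|exact: Glb].
apply/ler_addgt0Pr => e e0.
have [_ [a _ <-] Ga] := inf_adherent e0 (has_infG _ Dx).
have [_ [b _ <-] Gb] := inf_adherent e0 (has_infG _ Dy).
have h := cG _ _ a b _ Dx Dy t01.
have h' : inf (range (G (t *: x + (1 - t) *: y))) <=
    G (t *: x + (1 - t) *: y) (t * a + (1 - t) * b).
  by apply: ge_inf; [exact/Glb/cD|exists (t * a + (1 - t) * b)].
have := ler_wpM2l t0 (ltW Ga).
have t1' : 0 <= 1 - t by rewrite subr_ge0.
have := ler_wpM2l t1' (ltW Gb).
lra.
Qed.

Lemma dc_eq D f g : (forall x, D x -> f x = g x) -> dc_on D g -> dc_on D f.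
Proof.
by move=> fg [a [b [ca cb gE]]]; exists a, b; split=> // x Dx; rewrite fg// gE.
Qed.

Lemma dc_cvx D f : cvx D f -> dc_on D f.
Proof.
move=> cf; apply/dc_onP; exists f, (fun=> 0); split=> //; first exact: cvx_cst.
by move=> x _; rewrite subr0.
Qed.

Lemma dc_cst D c : dc_on D (fun=> c).
Proof. exact/dc_cvx/cvx_cst. Qed.

Lemma dcN D f : dc_on D f -> dc_on D (fun x => - f x).
Proof.
move=> [g [h [cg ch fE]]]; exists h, g; split=> // x Dx.
by rewrite fE// opprB.
Qed.

Lemma dcD D f g : dc_on D f -> dc_on D g -> dc_on D (fun x => f x + g x).
Proof.
move=> /dc_onP[f1 [f2 [cf1 cf2 fE]]] /dc_onP[g1 [g2 [cg1 cg2 gE]]].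
apply/dc_onP; exists (fun x => f1 x + g1 x), (fun x => f2 x + g2 x).
split; [exact: cvxD|exact: cvxD|].
by move=> x Dx; rewrite fE// gE//; ring.
Qed.

Lemma dcB D f g : dc_on D f -> dc_on D g -> dc_on D (fun x => f x - g x).
Proof. by move=> df dg; apply: dcD => //; exact: dcN. Qed.

Lemma dcZ D c f : dc_on D f -> dc_on D (fun x => c * f x).
Proof.
wlog c0 : c f / 0 <= c => [H|] df.
  have [c0|c0] := leP 0 c; first exact: H.
  apply: (@dc_eq _ _ (fun x => - c * - f x)); first by move=> x _; rewrite mulrNN.
  by apply: H; [rewrite oppr_ge0 ltW|exact: dcN].
move: df => /dc_onP[g [h [cg ch fE]]].
apply/dc_onP; exists (fun x => c * g x), (fun x => c * h x).
split; [exact: cvxZ|exact: cvxZ|].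
by move=> x Dx; rewrite fE// mulrBr.
Qed.

(* If [f i = g i - h i], adding all the [h j] makes every [f i] convex. *)
Lemma dc_max D (I : finType) (A : {pred I}) (f : I -> V -> R) F : cvx_set D ->
  (forall i, i \in A -> dc_on D (f i)) ->
  (forall i x, i \in A -> D x -> f i x <= F x) ->
  (forall x, D x -> exists2 i, i \in A & F x = f i x) -> dc_on D F.
Proof.
move=> cD df fF Ff.
have /choice[gh ghP] : forall i, exists gh : (V -> R) * (V -> R), i \in A ->
    [/\ cvx D gh.1, cvx D gh.2 & forall x, D x -> f i x = gh.1 x - gh.2 x].
  move=> i; have [Ai|_] := boolP (i \in A); last by exists (cst 0, cst 0).
  by have /dc_onP[g [h H]] := df _ Ai; exists (g, h).
pose H x := \sum_(i in A) (gh i).2 x.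
have cH : cvx D H by apply: cvx_sum => i /ghP[].
apply/dc_onP; exists (fun x => F x + H x), H; split=> //; last first.
  by move=> x _; rewrite addrK.
pose k i x := (gh i).1 x + \sum_(j in A | j != i) (gh j).2 x.
have kE i x : i \in A -> D x -> k i x = f i x + H x.
  move=> Ai Dx; rewrite /k /H (bigD1 i Ai)/= addrA; congr (_ + _).
  by have [_ _ ->] := ghP _ Ai => //; rewrite subrK.
apply: (@cvx_attained_sup D I (fun i => i \in A) k) => //.
- move=> i Ai; apply: cvxD; first by case: (ghP _ Ai).
  by apply: cvx_sum => j /andP[/ghP[]].
- by move=> i x Ai Dx; rewrite kE// lerD2r fF.
- by move=> x Dx; have [i Ai Fx] := Ff _ Dx; exists i => //; rewrite kE// Fx.
Qed.

Lemma dc_min D (I : finType) (A : {pred I}) (f : I -> V -> R) F : cvx_set D ->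
  (forall i, i \in A -> dc_on D (f i)) ->
  (forall i x, i \in A -> D x -> F x <= f i x) ->
  (forall x, D x -> exists2 i, i \in A & F x = f i x) -> dc_on D F.
Proof.
move=> cD df fF Ff.
apply: (@dc_eq _ _ (fun x => - - F x)); first by move=> x _; rewrite opprK.
apply: dcN; apply: (@dc_max _ _ A (fun i x => - f i x)) => //.
- by move=> i Ai; exact/dcN/df.
- by move=> i x Ai Dx; rewrite lerN2 fF.
- by move=> x Dx; have [i Ai ->] := Ff _ Dx; exists i.
Qed.

(* A functional that only depends on which of the values [z k x] lie below
   each level is a minimum, over the index sets A that force [m x <= eta], of
   the maxima of [z k x] over k in A. *)
Lemma dc_order_statistic D (K : finType) (z : K -> V -> R) (m : V -> R) :
  cvx_set D -> (forall k, dc_on D (z k)) ->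
  (forall x x' eta eta', D x -> D x' ->
    (forall k, z k x <= eta -> z k x' <= eta') -> m x <= eta -> m x' <= eta') ->
  dc_on D m.
Proof.
move=> cD dz H.
pose below x eta := [set k | z k x <= eta]%SET.
pose good (A : {set K}) :=
  `[< exists x eta, [/\ D x, m x <= eta & A = below x eta] >].
have good_neq0 A : good A -> exists k, k \in A.
  move=> /asboolP[x [eta [Dx mx AE]]]; apply: contrapT => nA.
  have := H x x eta (m x - 1) Dx Dx.
  suff h k : z k x <= eta -> z k x <= m x - 1.
    by move=> /(_ h mx); apply/negP; rewrite -ltNge ltrBlDr ltrDl.
  by move=> zk; exfalso; apply: nA; exists k; rewrite AE inE.
pose top (A : {set K}) x := if [pick k in A] is Some k0
  then z [arg max_(k > k0 in A) z k x]%O x else 0.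
have topP A x : good A ->
    (forall k, k \in A -> z k x <= top A x) /\
    exists2 k, k \in A & top A x = z k x.
  move=> /good_neq0[k0 k0A]; rewrite /top.
  case: pickP => [k1 k1A|/(_ k0)]; last by rewrite k0A.
  by case: arg_maxP => //= k kA kmax; split=> //; exists k.
apply: (@dc_min _ {set K} good top) => //.
- move=> A gA; apply: (@dc_max _ _ (mem A) z) => // [k x kA Dx|x Dx].
  + by apply: (topP _ _ gA).1.
  + exact: (topP _ _ gA).2.
- move=> A x gA Dx; have /asboolP[x0 [eta [Dx0 mx0 AE]]] := gA.
  apply: (H _ _ eta _ Dx0) => // k zk; apply: (topP _ _ gA).1.
  by rewrite AE inE.
- move=> x Dx; have gA : good (below x (m x)) by apply/asboolP; exists x, (m x).
  exists (below x (m x)) => //; apply/eqP; rewrite eq_le; apply/andP; split.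
    apply: (H _ _ (m x) _ Dx) => // k zk; apply: (topP _ _ gA).1.
    by rewrite inE.
  by have [_ [k]] := topP _ x gA; rewrite inE => ? ->.
Qed.

Lemma jensen D f (I : Type) (r : seq I) (w : I -> R) (v : I -> V) x c :
  cvx_set D -> cvx D f -> (forall i, 0 <= w i) -> (forall i, D (v i)) ->
  0 <= c -> D x -> c + \sum_(i <- r) w i = 1 ->
  D (c *: x + \sum_(i <- r) w i *: v i) /\
  f (c *: x + \sum_(i <- r) w i *: v i) <= c * f x + \sum_(i <- r) w i * f (v i).
Proof.
move=> cD cf w0 Dv; elim: r x c => [|i r IH] x c c0 Dx.
  by rewrite !big_nil !addr0 => ->; rewrite scale1r mul1r.
rewrite !big_cons !addrA => sum1.
have b0 : 0 <= c + w i by rewrite addr_ge0.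
have [bE|bN0] := eqVneq (c + w i) 0.
  have cE : c = 0 by move: (w0 i); lra.
  have wE : w i = 0 by move: (w0 i); lra.
  have := IH x _ b0 Dx sum1.
  by rewrite bE cE wE !scale0r !mul0r !addr0.
set b := c + w i in b0 bN0 sum1.
have bgt0 : 0 < b by rewrite lt_neqAle eq_sym bN0.
pose y := (c / b) *: x + (1 - c / b) *: v i.
have cb : 0 <= c / b <= 1.
  by rewrite divr_ge0//= ler_pdivrMr// mul1r lerDl.
have wE : b * (1 - c / b) = w i by rewrite /b; field.
have cE : b * (c / b) = c by field.
have yE : b *: y = c *: x + w i *: v i.
  by rewrite /y scalerDr !scalerA cE wE.
have [Dy fy] := IH _ _ b0 (cD _ _ _ Dx (Dv i) cb) sum1.
rewrite -yE; split=> //; apply: (le_trans fy).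
rewrite lerD2r; apply: (le_trans (ler_wpM2l b0 (cf _ _ _ Dx (Dv i) cb))).
by rewrite mulrDr (mulrA b (c / b)) (mulrA b (1 - c / b)) cE wE.
Qed.

Lemma finite_affine_span D :
  exists (k : nat) (v : 'I_k -> V) (l : 'I_k -> V -> R),
  [/\ forall i, D (v i),
      forall i x y t,
        l i (t *: x + (1 - t) *: y) = t * l i x + (1 - t) * l i y,
      forall x, D x -> \sum_i l i x = 1 &
      forall x, D x -> \sum_i l i x *: v i = x].
Proof.
pose ext x : (R^o * V)%type := (1, x).
have [s sD sspan] : exists2 s : seq V, {in s, forall x, D x} &
    forall x, D x -> ext x \in <<map ext s>>%VS.
  apply: contrapT => nos.
  have grow k : exists2 s : seq V, {in s, forall x, D x} &
      (k <= \dim <<map ext s>>)%N.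
    elim: k => [|k [s sD ks]]; first by exists [::].
    have [x Dx xs] : exists2 x, D x & ext x \notin <<map ext s>>%VS.
      apply: contrapT => nox; apply: nos; exists s => // x Dx.
      by apply/negPn/negP => xs; apply: nox; exists x.
    exists (x :: s); first by move=> y; rewrite inE => /predU1P[->|/sD].
    rewrite (leq_ltn_trans ks)//= span_cons.
    rewrite (ltn_leqif (dimv_leqif_sup (addvSr _ _))).
    apply: contra xs => /subvP; apply.
    by rewrite (subvP (addvSl _ _))// memv_line.
  have [s _] := grow (\dim {:(R^o * V)%type}).+1.
  by rewrite ltnNge dimvS// subvf.
pose X := in_tuple (map ext s).
have ltis (i : 'I_(size (map ext s))) : (i < size s)%N.
  by rewrite -(size_map ext) ltn_ord.
have Xi (i : 'I_(size (map ext s))) : X`_i = ext s`_i.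
  by rewrite /= (nth_map 0).
have XE x : D x -> ext x = \sum_i coord X i (ext x) *: X`_i.
  by move=> Dx; apply: coord_span; exact: sspan.
exists _, (fun i => s`_i), (fun i x => coord X i (ext x)); split.
- by move=> i; exact/sD/mem_nth.
- move=> i x y t; rewrite [ext _](_ : _ = t *: ext x + (1 - t) *: ext y).
    by rewrite linearD !linearZ.
  rewrite [RHS]surjective_pairing; congr pair => /=.
  by rewrite -scalerDl subrKC scale1r.
- move=> x Dx; have := congr1 fst (XE _ Dx).
  rewrite [in RHS](raddf_sum (@fst R^o V)) /= => oneE; rewrite [RHS]oneE.
  by apply: eq_bigr => i _; rewrite Xi /= /GRing.scale/= mulr1.
- move=> x Dx; have := congr1 snd (XE _ Dx).
  rewrite [in RHS](raddf_sum (@snd R^o V)) /= => xE; rewrite [RHS]xE.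
  by apply: eq_bigr => i _; rewrite Xi.
Qed.

(* A fixed interior point of the hull of the [v i] is a convex combination of
   the [v i] and of x in which x has a weight [(N x)^-1] that does not depend
   on the convex function. *)
Lemma cvx_lower_bound D : cvx_set D -> exists (r : seq V) (N : V -> R),
  [/\ {in r, forall v, D v}, cvx D N, forall x, 0 <= N x &
      forall f, cvx D f ->
        forall x, D x -> 0 <= f x + N x * \sum_(v <- r) `|f v|].
Proof.
move=> cD; have [k [v [l [Dv laff lsum lx]]]] := finite_affine_span D.
have [[x0 Dx0]|D0] := pselect (D !=set0); last first.
  exists [::], (fun=> 0); split=> // [|f _ x Dx]; first exact: cvx_cst.
  by exfalso; apply: D0; exists x.
have k0 : (0 < k)%N.
  move: v l Dv laff lsum lx; case: k => // v l _ _ /(_ x0 Dx0).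
  by rewrite big_ord0 => /eqP; rewrite eq_sym oner_eq0.
have kR : 0 < k%:R :> R by rewrite ltr0n.
have kN0 : k%:R != 0 :> R by rewrite gt_eqF.
pose N x : R := k%:R * (1 + \sum_i `|l i x|).
have N0 x : 0 < N x.
  by rewrite /N mulr_gt0// ltr_wpDr// sumr_ge0.
have cN : cvx D N.
  apply: cvxZ; first exact: ltW.
  apply: cvxD; first exact: cvx_cst.
  apply: cvx_sum => i _ x y t _ _ /andP[t0 t1].
  rewrite -subr_ge0 in t1.
  rewrite laff (le_trans (ler_normD _ _))// !normrM.
  by rewrite (ger0_norm t0) (ger0_norm t1).
pose c := \sum_i k%:R^-1 *: v i.
pose mu x i := k%:R^-1 - (N x)^-1 * l i x.
have mu0 x i : 0 <= mu x i.
  rewrite /mu subr_ge0 mulrC ler_pdivrMr// /N mulrA mulVf// mul1r.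
  rewrite (le_trans (ler_norm _))// ler_wpDl// (bigD1 i)//= lerDl.
  by rewrite sumr_ge0.
have mu_sum x : D x -> (N x)^-1 + \sum_i mu x i = 1.
  move=> Dx; rewrite big_split/= sumrN -mulr_sumr lsum// sumr_const card_ord.
  by rewrite -[_ *+ k]mulr_natl divff// mulr1 subrKC.
have cw x (Dx : D x) f : cvx D f -> D c /\
    f c <= (N x)^-1 * f x + \sum_i mu x i * f (v i).
  move=> cf; have -> : c = (N x)^-1 *: x + \sum_i mu x i *: v i.
    under eq_bigr do rewrite scalerBl -scalerA.
    by rewrite big_split/= sumrN -[X in _ - X]scaler_sumr lx// subrKC.
  by apply: jensen => //; [rewrite invr_ge0 ltW|exact: mu_sum].
exists (c :: [seq v i | i <- index_enum 'I_k]), N; split=> //.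
- move=> y; rewrite inE => /predU1P[->|/mapP[i _ ->]] //.
  by have [] := cw _ Dx0 _ (@cvx_cst D 0).
- by move=> x; exact: ltW.
move=> f cf x Dx; rewrite big_cons big_map.
have [_ fc] := cw _ Dx _ cf.
have mu1 i : mu x i <= 1.
  rewrite -(mu_sum _ Dx) (bigD1 i)//= addrCA lerDl addr_ge0 ?sumr_ge0//.
  by rewrite invr_ge0 ltW.
have sum_le : \sum_i mu x i * f (v i) <= \sum_i `|f (v i)|.
  apply: ler_sum => i _; rewrite (le_trans (ler_norm _))// normrM.
  by rewrite ler_piMl// ger0_norm.
have : 0 <= (N x)^-1 * f x + (`|f c| + \sum_i `|f (v i)|).
  by have := ler_norm (- f c); rewrite normrN; lra.
move=> /(ler_wpM2l (ltW (N0 x))); rewrite mulr0 mulrDr mulrA divff ?mul1r//.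
by rewrite gt_eqF.
Qed.

(* A common lower bound turns [g - h] into a difference of nonnegative convex
   functions, whose squares are convex. *)
Lemma dc_sqr D f : cvx_set D -> dc_on D f -> dc_on D (fun x => f x ^+ 2).
Proof.
move=> cD /dc_onP[g [h [cg ch fE]]].
have [r [N [_ cN N0 lb]]] := cvx_lower_bound cD.
pose K := \sum_(v <- r) `|g v| + \sum_(v <- r) `|h v|.
have sum0 (k : V -> R) : 0 <= \sum_(v <- r) `|k v| by exact: sumr_ge0.
have K0 : 0 <= K by rewrite addr_ge0.
pose G x := g x + K * N x; pose H x := h x + K * N x.
have cG : cvx D G by apply: cvxD => //; exact: cvxZ.
have cH : cvx D H by apply: cvxD => //; exact: cvxZ.
have G0 x : D x -> 0 <= G x.
  move=> Dx; rewrite /G /K mulrDl addrA addr_ge0 ?mulr_ge0//.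
  by rewrite mulrC lb.
have H0 x : D x -> 0 <= H x.
  move=> Dx; rewrite /H /K mulrDl addrCA addr_ge0 ?mulr_ge0//.
  by rewrite mulrC lb.
apply/dc_onP; exists (fun x => 2 * G x ^+ 2 + 2 * H x ^+ 2),
  (fun x => (G x + H x) ^+ 2); split.
- by apply: cvxD; apply: cvxZ => //; exact: cvx_sqr.
- apply: cvx_sqr => // [x Dx|]; first by rewrite addr_ge0 ?G0 ?H0.
  exact: cvxD.
- by move=> x Dx; rewrite fE// /G /H; ring.
Qed.

Lemma dcM D f g : cvx_set D -> dc_on D f -> dc_on D g ->
  dc_on D (fun x => f x * g x).
Proof.
move=> cD df dg.
apply: (@dc_eq _ _ (fun x => 4^-1 * ((f x + g x) ^+ 2 - (f x - g x) ^+ 2))).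
  by move=> x _; field.
by apply: dcZ; apply: dcB; apply: dc_sqr => //; [exact: dcD|exact: dcB].
Qed.

End DCFunctions.

Section Mean.
Context (d : measure_display) (T : measurableType d) (R : realType).
Variable P : probability T R.
Implicit Types (X Y : T -> R) (c : R).
Local Notation L1 X := (X \in Lfun P 1).

Lemma L1_measurable X : L1 X -> measurable_fun setT X.
Proof. by move=> /sub_Lfun_mfun; rewrite inE. Qed.

Lemma L1_le X Y : measurable_fun setT X -> (forall w, `|X w| <= Y w) ->
  L1 Y -> L1 X.
Proof.
move=> mX XY /Lfun1_integrable iY; apply/Lfun1_integrable.
apply: le_integrable iY => //; first exact/measurable_EFinP.
by move=> w _ /=; rewrite lee_fin (le_trans (XY w))// ler_norm.
Qed.

Lemma L1_cst c : L1 (fun=> c).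
Proof. exact: Lfun_cst. Qed.

Lemma L1D X Y : L1 X -> L1 Y -> L1 (fun w => X w + Y w).
Proof.
move=> /Lfun1_integrable iX /Lfun1_integrable iY; apply/Lfun1_integrable.
exact: integrableD iX iY.
Qed.

Lemma L1Z c X : L1 X -> L1 (fun w => c * X w).
Proof.
move=> /Lfun1_integrable iX; apply/Lfun1_integrable.
exact: integrableZl iX.
Qed.

Lemma L1N X : L1 X -> L1 (fun w => - X w).
Proof.
move=> /(L1Z (-1)); rewrite (_ : (fun _ => _) = (fun w => - X w))//.
by apply/funext => w; rewrite mulN1r.
Qed.

Lemma L1B X Y : L1 X -> L1 Y -> L1 (fun w => X w - Y w).
Proof. by move=> LX LY; apply: L1D => //; exact: L1N. Qed.

Lemma L1_norm X : L1 X -> L1 (fun w => `|X w|).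
Proof. by move=> LX; exact: (Lfun_norm LX). Qed.

Lemma L1_max X Y : L1 X -> L1 Y -> L1 (fun w => Num.max (X w) (Y w)).
Proof.
move=> LX LY.
apply: (@L1_le _ (fun w => `|X w| + `|Y w|)).
- by apply: measurable_maxr; exact: L1_measurable.
- by move=> w; rewrite /Num.max; case: ifP => _; rewrite ?lerDl ?lerDr.
- by apply: L1D; exact: L1_norm.
Qed.

Lemma mean_cst c : mean P (fun=> c) = c.
Proof. by rewrite /mean expectation_cst. Qed.

Lemma meanD X Y : L1 X -> L1 Y ->
  mean P (fun w => X w + Y w) = mean P X + mean P Y.
Proof.
by move=> LX LY; rewrite /mean (expectationD LX LY) fineD// expectation_fin_num.
Qed.

Lemma meanB X Y : L1 X -> L1 Y ->
  mean P (fun w => X w - Y w) = mean P X - mean P Y.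
Proof.
by move=> LX LY; rewrite /mean (expectationB LX LY) fineB// expectation_fin_num.
Qed.

Lemma meanZ c X : L1 X -> mean P (fun w => c * X w) = c * mean P X.
Proof.
move=> LX; have -> : (fun w => c * X w) = c \o* X.
  by apply/funext => w; rewrite mulrC.
by rewrite /mean (expectationZl c LX) fineM// expectation_fin_num.
Qed.

Lemma meanN X : L1 X -> mean P (fun w => - X w) = - mean P X.
Proof.
move=> LX; rewrite -[in RHS]mulN1r -meanZ//.
by congr mean; apply/funext => w; rewrite mulN1r.
Qed.

Lemma mean_ge0 X : (forall w, 0 <= X w) -> 0 <= mean P X.
Proof. by move=> X0; apply/fine_ge0/expectation_ge0. Qed.

Lemma mean_le X Y : L1 X -> L1 Y -> (forall w, X w <= Y w) ->
  mean P X <= mean P Y.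
Proof.
move=> LX LY XY; rewrite -subr_ge0 -meanB//; apply: mean_ge0 => w.
by rewrite subr_ge0.
Qed.

Lemma cvx_mean n (D : set 'rV[R]_n) (f : 'rV[R]_n -> T -> R) : cvx_set D ->
  (forall w, cvx D (f ^~ w)) -> (forall x, D x -> L1 (f x)) ->
  cvx D (fun x => mean P (f x)).
Proof.
move=> cD cf Lf x y t Dx Dy t01.
rewrite -!meanZ ?Lf// -meanD; [|exact/L1Z/Lf|exact/L1Z/Lf].
apply: mean_le => [||w]; last exact: cf.
- exact/Lf/cD.
- by apply: L1D; exact/L1Z/Lf.
Qed.

Definition sqint X := measurable_fun setT X /\ L1 (fun w => X w ^+ 2).

Lemma sqint_Lfun2 X : X \in Lfun P 2%:E -> sqint X.
Proof.
move=> LX; split; first by move/sub_Lfun_mfun : LX; rewrite inE.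
exact/Lfun1_integrable/Lfun2_integrable_sqr.
Qed.

Lemma sqint_cst c : sqint (fun=> c).
Proof. by split; [exact: measurable_cst|exact: L1_cst]. Qed.

Lemma sqintD X Y : sqint X -> sqint Y -> sqint (fun w => X w + Y w).
Proof.
move=> [mX LX] [mY LY].
have mXY : measurable_fun setT (fun w => X w + Y w) by exact: measurable_funD.
split=> //; apply: (@L1_le _ (fun w => 2 * X w ^+ 2 + 2 * Y w ^+ 2)).
- exact: measurable_funX.
- by move=> w; rewrite ger0_norm ?sqr_ge0//; have := sqr_ge0 (X w - Y w); nra.
- by apply: L1D; exact: L1Z.
Qed.

Lemma sqintZ c X : sqint X -> sqint (fun w => c * X w).
Proof.
move=> [mX LX]; split.
  by apply: measurable_funM => //; exact: measurable_cst.
rewrite (_ : (fun _ => _) = fun w => c ^+ 2 * X w ^+ 2); first exact: L1Z.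
by apply/funext => w; rewrite exprMn.
Qed.

Lemma sqint_norm X : sqint X -> sqint (fun w => `|X w|).
Proof.
move=> [mX LX]; split; first exact: measurableT_comp.
by under eq_fun do rewrite real_normK ?num_real//.
Qed.

Lemma sqint_sum (I : Type) (r : seq I) (X : I -> T -> R) :
  (forall i, sqint (X i)) -> sqint (fun w => \sum_(i <- r) X i w).
Proof.
move=> LX; elim: r => [|i r IH].
  rewrite (_ : (fun _ => _) = fun=> 0); first exact: sqint_cst.
  by apply/funext => w; rewrite big_nil.
rewrite (_ : (fun _ => _) = fun w => X i w + \sum_(i <- r) X i w).
  exact: sqintD.
by apply/funext => w; rewrite big_cons.
Qed.

End Mean.

Section MeanDC.
Context (d : measure_display) (T : measurableType d) (R : realType).
Variable P : probability T R.
Context (n : nat) (D : set 'rV[R]_n) (p q : 'rV[R]_n -> T -> R).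
Hypothesis cD : cvx_set D.
Hypothesis cp : forall w, cvx D (p ^~ w).
Hypothesis cq : forall w, cvx D (q ^~ w).
Hypothesis Lp : forall x, D x -> p x \in Lfun P 1.
Hypothesis Lq : forall x, D x -> q x \in Lfun P 1.
Local Notation Z := (fun x w => p x w - q x w).
Implicit Types (b : 'rV[R]_n -> R).

Lemma L1_difference x : D x -> Z x \in Lfun P 1.
Proof. by move=> Dx; apply: L1B; [exact: Lp|exact: Lq]. Qed.

Lemma dc_mean : dc_on D (fun x => mean P (Z x)).
Proof.
apply: (@dc_eq _ _ _ _ (fun x => mean P (p x) - mean P (q x))).
  by move=> x Dx; rewrite meanB ?Lp ?Lq.
by apply: dcB; apply/dc_cvx/cvx_mean.
Qed.

(* max(0, p - q - b1 + b2) = max(p + b2, q + b1) - (q + b1) *)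
Lemma dc_plus_dev b : dc_on D b -> dc_on D (fun x => plus_dev P (b x) (Z x)).
Proof.
move=> /dc_onP[b1 [b2 [cb1 cb2 bE]]].
pose F x w := Num.max (p x w + b2 x) (q x w + b1 x).
have LF1 x : D x -> (fun w => p x w + b2 x) \in Lfun P 1.
  by move=> Dx; apply: L1D; [exact: Lp|exact: L1_cst].
have LF2 x : D x -> (fun w => q x w + b1 x) \in Lfun P 1.
  by move=> Dx; apply: L1D; [exact: Lq|exact: L1_cst].
have LF x : D x -> F x \in Lfun P 1.
  by move=> Dx; apply: L1_max; [exact: LF1|exact: LF2].
apply: (@dc_eq _ _ _ _
    (fun x => mean P (F x) - mean P (fun w => q x w + b1 x))).
  move=> x Dx; rewrite -meanB ?LF ?LF2// /plus_dev bE//; congr mean.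
  apply/funext => w; rewrite /F -[X in _ - X]add0r addr_maxl.
  by rewrite maxC; congr Num.max; ring.
apply: dcB; apply/dc_cvx/cvx_mean => // w; last by apply: cvxD.
by apply: cvx_max => //; apply: cvxD.
Qed.

Lemma dc_abs_dev b : dc_on D b -> dc_on D (fun x => abs_dev P (b x) (Z x)).
Proof.
move=> db; apply: (@dc_eq _ _ _ _
    (fun x => 2 * plus_dev P (b x) (Z x) - (mean P (Z x) - b x))).
  move=> x Dx; have LZ := L1_difference Dx.
  have LZb : (fun w => Z x w - b x) \in Lfun P 1.
    by apply: L1B => //; exact: L1_cst.
  have LM : (fun w => Num.max 0 (Z x w - b x)) \in Lfun P 1.
    by apply: L1_max => //; exact: L1_cst.
  rewrite -[X in mean P _ - X](mean_cst P (b x)) -meanB//; last exact: L1_cst.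
  rewrite /plus_dev -meanZ// -meanB//; last exact: L1Z.
  congr mean; apply/funext => w; set y := p x w - q x w - b x.
  by have [y0|y0] := leP 0 y; [rewrite ger0_norm//|rewrite ltr0_norm//]; ring.
apply: dcB; first by apply: dcZ; exact: dc_plus_dev.
by apply: dcB => //; exact: dc_mean.
Qed.

Lemma dc_mean_sqr : (forall x, D x -> sqint P (p x)) ->
  (forall x, D x -> sqint P (q x)) ->
  dc_on D (fun x => mean P (fun w => Z x w ^+ 2)).
Proof.
move=> sp sq.
have [r [N [rD cN N0 lb]]] := cvx_lower_bound cD.
pose K w := \sum_(v <- r) `|if `[< D v >] then p v w else 0| +
            \sum_(v <- r) `|if `[< D v >] then q v w else 0|.
have sum0 (k : 'rV[R]_n -> R) : 0 <= \sum_(v <- r) `|k v| by exact: sumr_ge0.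
have K0 w : 0 <= K w by rewrite addr_ge0.
have sK : sqint P K.
  apply: sqintD; apply: sqint_sum => v; apply: sqint_norm; case: asboolP => Dv;
    by [exact: sp|exact: sq|exact: sqint_cst].
pose F x w := p x w + N x * K w; pose G x w := q x w + N x * K w.
have cF w : cvx D (F ^~ w).
  by apply: cvxD => //; under eq_fun do rewrite mulrC; exact: cvxZ.
have cG w : cvx D (G ^~ w).
  by apply: cvxD => //; under eq_fun do rewrite mulrC; exact: cvxZ.
have sumE (k : 'rV[R]_n -> T -> R) w :
    \sum_(v <- r) `|if `[< D v >] then k v w else 0| = \sum_(v <- r) `|k v w|.
  by apply: eq_big_seq => v /rD Dv; rewrite asboolT.
have F0 w x : D x -> 0 <= F x w.
  move=> Dx; rewrite /F /K !sumE mulrDr addrA addr_ge0 ?mulr_ge0//.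
  exact: (lb (p ^~ w)).
have G0 w x : D x -> 0 <= G x w.
  move=> Dx; rewrite /G /K !sumE mulrDr addrCA addr_ge0 ?mulr_ge0//.
  exact: (lb (q ^~ w)).
have sF x : D x -> sqint P (F x).
  by move=> Dx; apply: sqintD; [exact: sp|exact: sqintZ].
have sG x : D x -> sqint P (G x).
  by move=> Dx; apply: sqintD; [exact: sq|exact: sqintZ].
have LFG x : D x -> (fun w => 2 * F x w ^+ 2 + 2 * G x w ^+ 2) \in Lfun P 1.
  by move=> Dx; apply: L1D; apply: L1Z; [apply: (sF _ Dx).2|apply: (sG _ Dx).2].
have LFG2 x : D x -> (fun w => (F x w + G x w) ^+ 2) \in Lfun P 1.
  by move=> Dx; apply: (sqintD (sF _ Dx) (sG _ Dx)).2.
apply: (@dc_eq _ _ _ _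
    (fun x => mean P (fun w => 2 * F x w ^+ 2 + 2 * G x w ^+ 2) -
              mean P (fun w => (F x w + G x w) ^+ 2))).
  move=> x Dx; rewrite -meanB ?LFG ?LFG2//; congr mean.
  by apply/funext => w; rewrite /F /G; ring.
apply: dcB; apply/dc_cvx/cvx_mean => // w.
- apply: cvxD; apply: cvxZ => //; apply: cvx_sqr => //.
  + exact: F0.
  + exact: G0.
- apply: cvx_sqr => // [x Dx|]; first by rewrite addr_ge0 ?F0 ?G0.
  exact: cvxD.
Qed.

Lemma dc_sq_dev b : (forall x, D x -> sqint P (p x)) ->
  (forall x, D x -> sqint P (q x)) ->
  dc_on D b -> dc_on D (fun x => sq_dev P (b x) (Z x)).
Proof.
move=> sp sq db; apply: (@dc_eq _ _ _ _ (fun x =>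
    mean P (fun w => Z x w ^+ 2) - 2 * (b x * mean P (Z x)) + b x * b x)).
  move=> x Dx; have LZ := L1_difference Dx.
  have LZ2 : (fun w => Z x w ^+ 2) \in Lfun P 1.
    have /sqintD : sqint P (p x) by exact: sp.
    move=> /(_ _ (sqintZ (-1) (sq _ Dx)))[_].
    rewrite (_ : (fun _ => _) = fun w => Z x w ^+ 2)//.
    by apply/funext => w; rewrite mulN1r.
  rewrite mulrA -meanZ// -meanB//; last exact: L1Z.
  rewrite -[X in _ + X](mean_cst P) -meanD; last 2 first.
  - by apply: L1B => //; exact: L1Z.
  - exact: L1_cst.
  by congr mean; apply/funext => w; ring.
apply: dcD; last exact: dcM.
apply: dcB; first exact: dc_mean_sqr.
by apply: dcZ; apply: dcM => //; exact: dc_mean.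
Qed.

End MeanDC.

Section FiniteSpace.
Context (d : measure_display) (T : measurableType d) (R : realType).
Variable P : probability T R.
Implicit Types (X Y : T -> R).

Lemma finite_discrete_enum : finite_discrete T ->
  exists s : seq T, forall w, w \in s.
Proof.
move=> [/finite_seqP[s sE] _]; exists s => w.
by have : [set: T] w by []; rewrite sE.
Qed.

Lemma finite_discrete_L1 X : finite_discrete T -> X \in Lfun P 1.
Proof.
move=> fT; have [s sT] := finite_discrete_enum fT.
apply: (@L1_le _ _ _ _ _ (fun=> \sum_(w <- s) `|X w|)); last exact: L1_cst.
  move=> _ B _; apply: countable_measurable fT.2 _.
  exact/finite_set_countable/(sub_finite_set (@subsetT _ _) fT.1).
move=> w; rewrite (big_rem w)//= lerDl.
by rewrite sumr_ge0.
Qed.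

Definition rms X : R := Num.sqrt (mean P (fun w => X w ^+ 2)).

Lemma rms_ge0 X : 0 <= rms X.
Proof. exact: sqrtr_ge0. Qed.

Lemma rms_sqr X : rms X ^+ 2 = mean P (fun w => X w ^+ 2).
Proof. by rewrite sqr_sqrtr// mean_ge0// => w; exact: sqr_ge0. Qed.

Lemma rmsZ c X : finite_discrete T -> 0 <= c ->
  rms (fun w => c * X w) = c * rms X.
Proof.
move=> fT c0; rewrite /rms.
have -> : (fun w => (c * X w) ^+ 2) = fun w => c ^+ 2 * X w ^+ 2.
  by apply/funext => w; rewrite exprMn.
rewrite meanZ ?finite_discrete_L1// sqrtrM ?sqr_ge0// sqrtr_sqr.
by rewrite ger0_norm.
Qed.

(* For a, b > 0, (x + y)^2 <= (a + b) (x^2 / a + y^2 / b); take a and b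
   slightly above the norms of X and Y. *)
Lemma rmsD X Y : finite_discrete T ->
  rms (fun w => X w + Y w) <= rms X + rms Y.
Proof.
move=> fT; apply/ler_addgt0Pr => e e0.
have e2 : 0 < e / 2 by rewrite divr_gt0.
pose a := rms X + e / 2; pose b := rms Y + e / 2.
have a0 : 0 < a by rewrite ltr_wpDl// rms_ge0.
have b0 : 0 < b by rewrite ltr_wpDl// rms_ge0.
have -> : rms X + rms Y + e = a + b by rewrite /a /b; field.
have ab0 : 0 <= a + b by rewrite addr_ge0 ?ltW.
rewrite -ler_sqr ?nnegrE ?rms_ge0// rms_sqr.
apply: (@le_trans _ _ (mean P (fun w =>
    (a + b) / a * X w ^+ 2 + (a + b) / b * Y w ^+ 2))).
  apply: mean_le => [||w]; [exact: finite_discrete_L1|exact: finite_discrete_L1|].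
  rewrite -subr_ge0 [leRHS](_ : _ = (b * X w - a * Y w) ^+ 2 / (a * b)).
    by rewrite divr_ge0 ?sqr_ge0// mulr_ge0 ?ltW.
  by field; rewrite ?gt_eqF.
rewrite meanD ?finite_discrete_L1// !meanZ ?finite_discrete_L1// -!rms_sqr.
have le1 : rms X ^+ 2 <= a ^+ 2.
  by rewrite ler_sqr ?nnegrE ?rms_ge0 ?(ltW a0)// lerDl ltW.
have le2 : rms Y ^+ 2 <= b ^+ 2.
  by rewrite ler_sqr ?nnegrE ?rms_ge0 ?(ltW b0)// lerDl ltW.
rewrite [leRHS](_ : _ = (a + b) / a * a ^+ 2 + (a + b) / b * b ^+ 2).
  by apply: lerD; apply: ler_wpM2l => //; rewrite divr_ge0// ltW.
by field; rewrite ?gt_eqF.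
Qed.

Lemma rms_le_sum (s : seq T) X : finite_discrete T -> (forall w, w \in s) ->
  rms X <= \sum_(w <- s) `|X w|.
Proof.
move=> fT sT; have S0 : 0 <= \sum_(w <- s) `|X w| by exact: sumr_ge0.
rewrite -ler_sqr ?nnegrE ?rms_ge0// rms_sqr -[leRHS](mean_cst P).
apply: mean_le => [||w]; [exact: finite_discrete_L1|exact: finite_discrete_L1|].
rewrite -[leLHS]real_normK ?num_real// ler_sqr ?nnegrE//.
by rewrite (big_rem w)//= lerDl sumr_ge0.
Qed.

(* [rms (f - g) + \sum (f + g)] is convex in (f, g) and nondecreasing in every
   coordinate of f and g, hence convex in x. *)
Lemma dc_rms n (D : set 'rV[R]_n) (f g : 'rV[R]_n -> T -> R) :
  finite_discrete T -> cvx_set D ->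
  (forall w, cvx D (f ^~ w)) -> (forall w, cvx D (g ^~ w)) ->
  dc_on D (fun x => rms (fun w => f x w - g x w)).
Proof.
move=> fT cD cf cg; have [s sT] := finite_discrete_enum fT.
pose S x := \sum_(w <- s) (f x w + g x w).
have cS : cvx D S by apply: cvx_sum => w _; exact: cvxD.
apply/dc_onP; exists (fun x => rms (fun w => f x w - g x w) + S x), S.
split=> // [x y t Dx Dy /[dup] t01 /andP[t0 t1]|x _]; last by rewrite addrK.
set z := t *: x + (1 - t) *: y.
have t1' : 0 <= 1 - t by rewrite subr_ge0.
pose df w := t * f x w + (1 - t) * f y w - f z w.
pose dg w := t * g x w + (1 - t) * g y w - g z w.
have df0 w : 0 <= df w by rewrite subr_ge0 cf.
have dg0 w : 0 <= dg w by rewrite subr_ge0 cg.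
have -> : (fun w => f z w - g z w) = fun w =>
    (t * (f x w - g x w) + (1 - t) * (f y w - g y w)) + (dg w - df w).
  by apply/funext => w; rewrite /df /dg; ring.
have rms_tri := rmsD (fun w => t * (f x w - g x w))
  (fun w => (1 - t) * (f y w - g y w)) fT.
rewrite !rmsZ// in rms_tri.
have err : rms (fun w => dg w - df w) <= t * S x + (1 - t) * S y - S z.
  apply: (le_trans (rms_le_sum _ fT sT)).
  rewrite /S !mulr_sumr -big_split -sumrB/=; apply: ler_sum => w _.
  apply: (@le_trans _ _ (dg w + df w)); last by rewrite /df /dg; lra.
  by rewrite (le_trans (ler_normB _ _))// !ger0_norm.
have := rmsD (fun w => t * (f x w - g x w) + (1 - t) * (f y w - g y w))
  (fun w => dg w - df w) fT.
lra.
Qed.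

End FiniteSpace.

Lemma uniform_right_radius (R : realType) (K : eqType) (r : seq K)
    (Q : K -> R -> Prop) :
  (forall k, k \in r -> exists2 e, 0 < e & forall h, 0 < h <= e -> Q k h) ->
  exists2 e, 0 < e & forall k h, k \in r -> 0 < h <= e -> Q k h.
Proof.
elim: r => [|k r IH] H; first by exists 1.
have [e e0 Qe] := H k (mem_head _ _).
have [|f f0 Qf] := IH; first by move=> j jr; apply: H; rewrite inE jr orbT.
exists (Num.min e f); first by rewrite lt_min e0.
move=> j h; rewrite le_min inE => /predU1P[->|jr] /and3P[h0 he hf].
  by apply: Qe; rewrite h0.
by apply: Qf => //; rewrite h0.
Qed.

Section PiecewiseLinear.
Context (R : realType) (I : finType) (a c : I -> R) (v : R -> R).
Hypothesis a0 : forall i, 0 <= a i.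
Hypothesis v_le : forall i t, v t <= a i * t + c i.
Hypothesis v_attained : forall t, exists i, v t = a i * t + c i.

Lemma pl_dist s t : `|v t - v s| <= (\sum_i a i) * `|t - s|.
Proof.
wlog vst : s t / v s <= v t => [H|].
  by have [/H//|/ltW/H] := leP (v s) (v t); rewrite distrC (distrC s).
have [i vs] := v_attained s.
rewrite ger0_norm ?subr_ge0//.
have ai : a i <= \sum_j a j by rewrite (bigD1 i)//= lerDl sumr_ge0.
apply: (@le_trans _ _ (a i * (t - s))); first by have := v_le i t; lra.
apply: (@le_trans _ _ (a i * `|t - s|)); first by rewrite ler_wpM2l// ler_norm.
by rewrite ler_wpM2r.
Qed.

Lemma pl_continuous : continuous v.
Proof.
move=> t; apply/cvgrPdist_le => /= e e0.
have A0 : 0 < 1 + \sum_i a i by rewrite ltr_pwDl// sumr_ge0.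
near=> s; apply: (le_trans (pl_dist _ _)).
apply: (@le_trans _ _ ((1 + \sum_i a i) * (e / (1 + \sum_i a i)))).
  apply: ler_pM => //; [exact: sumr_ge0|by rewrite lerDr|].
  near: s; apply: cvgr_dist_le => //; rewrite divr_gt0//.
by rewrite mulrC divfK// gt_eqF.
Unshelve. all: by end_near. Qed.

(* The left derivative of v. *)
Lemma pl_slope : exists sl : R -> R, forall t,
  (exists i, v t = a i * t + c i /\ sl t = a i) /\
  (forall i, v t = a i * t + c i -> a i <= sl t).
Proof.
suff /choice[sl slP] : forall t, exists s,
    (exists i, v t = a i * t + c i /\ s = a i) /\
    (forall i, v t = a i * t + c i -> a i <= s) by exists sl.
move=> t.
have [i0 vi0] := v_attained t.
have P0 : v t == a i0 * t + c i0 by apply/eqP.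
case: (@Order.TotalTheory.arg_maxP _ R I i0
  (fun i => v t == a i * t + c i) a P0) => i /eqP vi imax.
by exists (a i); split; [exists i|move=> j /eqP /imax].
Qed.

End PiecewiseLinear.

Section OptimizedCertaintyEquivalent.
Context (d : measure_display) (T : measurableType d) (R : realType).
Variable P : probability T R.
Context (I : finType) (a c : I -> R) (v : R -> R).
Hypothesis a0 : forall i, 0 <= a i.
Hypothesis v_le : forall i t, v t <= a i * t + c i.
Hypothesis v_attained : forall t, exists i, v t = a i * t + c i.
Implicit Types (X : T -> R).

Definition oce_real X eta : R := eta + mean P (fun w => v (X w - eta)).

Lemma L1_pl X : X \in Lfun P 1 -> (fun w => v (X w)) \in Lfun P 1.
Proof.
move=> LX; apply: (@L1_le _ _ _ _ _
    (fun w => `|v 0| + (\sum_i a i) * `|X w|)).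
- apply: (@measurableT_comp _ _ _ _ _ _ v); last exact: L1_measurable LX.
  apply: continuous_measurable_fun; apply: (pl_continuous a0 v_le v_attained).
- move=> w; have := pl_dist a0 v_le v_attained 0 (X w).
  rewrite subr0 => h; have := ler_normD (v 0) (v (X w) - v 0).
  by rewrite subrKC; lra.
- apply: L1D; first exact: L1_cst.
  exact/L1Z/L1_norm.
Qed.

Lemma L1_pl_shift X eta : X \in Lfun P 1 ->
  (fun w => v (X w - eta)) \in Lfun P 1.
Proof.
move=> LX; apply: (@L1_pl (fun w => X w - eta)).
by apply: L1B => //; exact: L1_cst.
Qed.

Context (n : nat) (D : set 'rV[R]_n) (p q : 'rV[R]_n -> T -> R).
Hypothesis cD : cvx_set D.
Hypothesis cp : forall w, cvx D (p ^~ w).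
Hypothesis cq : forall w, cvx D (q ^~ w).
Hypothesis Lp : forall x, D x -> p x \in Lfun P 1.
Hypothesis Lq : forall x, D x -> q x \in Lfun P 1.
Local Notation Z := (fun x w => p x w - q x w).

Lemma dc_sup_oce : (forall x, D x -> has_ubound (range (oce_real (Z x)))) ->
  dc_on D (fun x => sup (range (oce_real (Z x)))).
Proof.
move=> ubH; pose A := \sum_i a i.
have aA i : a i <= A by rewrite /A (bigD1 i)//= lerDl sumr_ge0.
pose M x eta w := A * p x w - v (Z x w - eta).
pose G x eta := mean P (M x eta) - eta.
have LZ x : D x -> Z x \in Lfun P 1 by exact: L1_difference.
have LM x eta : D x -> M x eta \in Lfun P 1.
  by move=> Dx; apply: L1B; [exact/L1Z/Lp|exact/L1_pl_shift/LZ].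
have GE x eta : D x -> G x eta = A * mean P (p x) - oce_real (Z x) eta.
  move=> Dx; rewrite /G /M meanB; last 2 first.
  - exact/L1Z/Lp.
  - exact/L1_pl_shift/LZ.
  by rewrite meanZ ?Lp// /oce_real; ring.
have Glb x : D x -> has_lbound (range (G x)).
  move=> Dx; have [u uH] := ubH _ Dx.
  exists (A * mean P (p x) - u) => _ [eta _ <-]; rewrite GE// lerD2l lerN2.
  by apply: uH; exists eta.
apply: (@dc_eq _ _ _ _ (fun x => A * mean P (p x) - inf (range (G x)))).
  move=> x Dx; apply/le_anti/andP; split.
    apply: sup_le_ub; first by exists (oce_real (Z x) 0), 0.
    move=> _ [eta _ <-]; rewrite lerBrDr -lerBrDl -GE//.
    by apply: ge_inf; [exact: Glb|exists eta].
  rewrite lerBlDr -lerBlDl; apply: lb_le_inf; first by exists (G x 0), 0.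
  move=> _ [eta _ <-]; rewrite GE// lerD2l lerN2.
  by apply: ub_le_sup; [exact: ubH|exists eta].
apply: dcB; first by apply/dcZ/dc_cvx/cvx_mean.
apply/dc_cvx/cvx_inf => // x y e f t Dx Dy /[dup] t01 /andP[t0 t1].
have t1' : 0 <= 1 - t by rewrite subr_ge0.
have cM w : M (t *: x + (1 - t) *: y) (t * e + (1 - t) * f) w <=
    t * M x e w + (1 - t) * M y f w.
  rewrite /M; set zt := _ - _ - _; have [i ->] := v_attained zt.
  have vx := ler_wpM2l t0 (v_le i (Z x w - e)).
  have vy := ler_wpM2l t1' (v_le i (Z y w - f)).
  have hp' : (A - a i) * p (t *: x + (1 - t) *: y) w <=
    (A - a i) * (t * p x w + (1 - t) * p y w).
    by rewrite ler_wpM2l ?subr_ge0// cp.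
  have hq' := ler_wpM2l (a0 i) (cq w Dx Dy t01).
  rewrite /zt; rewrite /= in hq'; lra.
have := mean_le (LM _ (t * e + (1 - t) * f) (cD Dx Dy t01))
  (L1D (L1Z t (LM _ e Dx)) (L1Z (1 - t) (LM _ f Dy))) cM.
rewrite meanD ?meanZ ?LM//; [|exact/L1Z/LM|exact/L1Z/LM].
by rewrite /G; lra.
Qed.

Definition oce_real_argmax X : set R :=
  [set eta' | forall eta, oce_real X eta <= oce_real X eta'].

Section LeftSlope.
Variable sl : R -> R.
Hypothesis sl_active : forall t, exists i, v t = a i * t + c i /\ sl t = a i.
Hypothesis sl_max : forall t i, v t = a i * t + c i -> a i <= sl t.

Lemma pl_supergradient t s : v s <= v t + sl t * (s - t).
Proof.
by have [i [-> ->]] := sl_active t; apply: (le_trans (v_le i s)); lra.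
Qed.

Lemma pl_left_linear t : exists2 e, 0 < e &
  forall h, 0 < h <= e -> v t - sl t * h <= v (t - h).
Proof.
have [|e e0 H] := @uniform_right_radius R I (index_enum I)
    (fun i h => v t - sl t * h <= a i * (t - h) + c i).
- move=> i _; have [ai|ai] := leP (a i) (sl t).
    exists 1 => // h /andP[h0 _].
    have := ler_wpM2r (ltW h0) ai; have := v_le i t; lra.
  have vlt : v t < a i * t + c i.
    rewrite lt_neqAle v_le andbT; apply/eqP => /sl_max.
    by rewrite leNgt ai.
  exists ((a i * t + c i - v t) / (a i - sl t)).
    by rewrite divr_gt0// subr_gt0.
  move=> h /andP[h0]; rewrite ler_pdivlMr ?subr_gt0//; lra.
- exists e => // h h0e; have [i ->] := v_attained (t - h).
  by apply: H => //; exact: mem_index_enum.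
Qed.

(* For [a j < a k], line k is below line j exactly on the left of the abscissa
   of their intersection. *)
Definition crossing k j := (c j - c k) / (a k - a j).

Lemma le_crossing k j t : a j < a k ->
  (t <= crossing k j) = (a k * t + c k <= a j * t + c j).
Proof.
move=> ajk; rewrite ler_pdivlMr ?subr_gt0//.
by apply/idP/idP; lra.
Qed.

Lemma le_slope t t' :
  (forall k j, a j < a k -> t <= crossing k j -> t' <= crossing k j) ->
  sl t <= sl t'.
Proof.
move=> H; have [k [vk ->]] := sl_active t; have [j [vj sj]] := sl_active t'.
rewrite leNgt sj; apply/negP => ajk.
have : t' <= crossing k j by apply: H => //; rewrite le_crossing// -vk v_le.
rewrite le_crossing// -vj => kv.
have /sl_max : v t' = a k * t' + c k by apply/le_anti; rewrite v_le kv.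
by rewrite sj leNgt ajk.
Qed.

Lemma slope_antitone t t' : t' <= t -> sl t <= sl t'.
Proof. by move=> tt'; apply: le_slope => k j _; exact: le_trans. Qed.

Lemma largest_maximizer_le X m eta : finite_discrete T ->
  is_maximum (oce_real_argmax X) m ->
  (m <= eta) <-> (1 < mean P (fun w => sl (X w - eta))).
Proof.
move=> fT [Am um].
have L1T Y : Y \in Lfun P 1 by exact: finite_discrete_L1.
have mean_slope e h Y :
    mean P (fun w => v (Y w - e) + h * sl (Y w - e)) =
    mean P (fun w => v (Y w - e)) + h * mean P (fun w => sl (Y w - e)).
  by rewrite meanD// meanZ.
split=> [me|S1]; last first.
  rewrite leNgt; apply/negP => em.
  have := Am eta; apply/negP; rewrite -ltNge /oce_real.
  have : mean P (fun w => v (X w - m)) <=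
      mean P (fun w => v (X w - eta) + (eta - m) * sl (X w - eta)).
    apply: mean_le => // w; apply: (le_trans (pl_supergradient (X w - eta) _)).
    lra.
  rewrite mean_slope; set S := mean P (fun w => sl _) in S1 *.
  have : (m - eta) * 1 < (m - eta) * S by rewrite ltr_pM2l// subr_gt0.
  lra.
rewrite ltNge; apply/negP => S1.
have {}S1 : mean P (fun w => sl (X w - m)) <= 1.
  apply: le_trans S1; apply: mean_le => // w; apply: slope_antitone.
  by rewrite lerD2l lerN2.
have [s sT] := finite_discrete_enum fT.
have [w _|e e0 H] := @uniform_right_radius R T s (fun w h =>
    v (X w - m) - sl (X w - m) * h <= v (X w - m - h)).
  exact: pl_left_linear.
have : m + e <= m.
  apply: um => t; apply: (le_trans (Am t)); rewrite /oce_real.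
  have : mean P (fun w => v (X w - m) + (- e) * sl (X w - m)) <=
      mean P (fun w => v (X w - (m + e))).
    apply: mean_le => // w; rewrite opprD addrA.
    apply: le_trans (H w e _ _); [lra|exact: sT|by rewrite e0 lexx].
  rewrite mean_slope; have := ler_wpM2l (ltW e0) S1; lra.
by apply/negP; rewrite -ltNge ltrDl.
Qed.

Lemma dc_largest_maximizer m : finite_discrete T ->
  (forall x, D x -> is_maximum (oce_real_argmax (Z x)) (m x)) -> dc_on D m.
Proof.
move=> fT mP; have [s sT] := finite_discrete_enum fT.
pose K := ('I_(size s) * I * I)%type.
pose e (k : K) := tnth (in_tuple s) k.1.1.
apply: (@dc_order_statistic _ _ _ K
    (fun k x => Z x (e k) - crossing k.1.2 k.2)) => // [k|x x' eta eta' Dx Dx' H].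
  apply: dcB; last exact: dc_cst.
  by apply: dcB; apply: dc_cvx.
move=> /(largest_maximizer_le _ fT (mP _ Dx)) S1.
apply/(largest_maximizer_le _ fT (mP _ Dx')); apply: (lt_le_trans S1).
apply: mean_le => [||w]; [exact: finite_discrete_L1|exact: finite_discrete_L1|].
apply: le_slope => k j ajk.
have swap (y z t : R) : (y - z <= t) = (y - t <= z) by rewrite lerBlDr -lerBlDl.
rewrite (swap (Z x w)) (swap (Z x' w)).
have /tnthP[i ->] : w \in in_tuple s by exact: sT.
exact: (H (i, k, j)).
Qed.

End LeftSlope.

End OptimizedCertaintyEquivalent.

Section Extrema.
Context (R : realType).
Implicit Types (A : set R) (m : R) (phi : R -> R).

Lemma minimumE A m : is_minimum A m -> minimum A = m.
Proof.
move=> [Am lbm]; have [Ax lbx] : is_minimum A (minimum A).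
  by apply: xgetPex; exists m.
by apply/le_anti; rewrite lbx// lbm.
Qed.

Lemma maximumE A m : is_maximum A m -> maximum A = m.
Proof.
move=> [Am ubm]; have [Ax ubx] : is_maximum A (maximum A).
  by apply: xgetPex; exists m.
by apply/le_anti; rewrite ubm// ubx.
Qed.

Lemma smallest_minimizer_exists phi (K lo hi : R) : 0 <= K -> lo <= 0 <= hi ->
  (forall s t, phi s <= phi t + K * `|t - s|) ->
  (forall t, phi t <= phi 0 -> lo <= t <= hi) ->
  exists m, is_minimum [set t' | forall t, phi t' <= phi t] m.
Proof.
move=> K0 /andP[lo0 hi0] phiK bnd.
have K1 : 0 < 1 + K by rewrite ltr_pwDl.
have cphi : continuous phi.
  move=> t; apply/cvgrPdist_le => /= e e0.
  near=> s; apply: (@le_trans _ _ ((1 + K) * `|t - s|)).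
    have := phiK s t; have := phiK t s; rewrite (distrC s t).
    by have := normr_ge0 (t - s); rewrite ler_norml; lra.
  rewrite mulrC -ler_pdivlMr//; near: s.
  by apply: cvgr_dist_le => //; rewrite divr_gt0.
have lohi : lo <= hi by exact: le_trans hi0.
have [t0 t0in t0min] := @EVT_min R phi lo hi lohi
  (continuous_subspaceT cphi).
have {}t0min t : phi t0 <= phi t.
  have [/t0min//|] := boolP (t \in `[lo, hi]).
  have := t0min 0; rewrite !in_itv/= lo0 hi0 => /(_ isT) t00 nt.
  apply: (le_trans t00); apply/ltW; rewrite ltNge; apply: contra nt.
  exact: bnd.
set S := [set _ | _].
have St0 : S t0 by [].
have lbS : has_lbound S by exists lo => t St; have /andP[] := bnd t (St 0).
have infS : has_inf S by split; [exists t0|].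
exists (inf S); split; last by move=> t St; exact: ge_inf.
move=> t; apply: le_trans (t0min t); apply/ler_addgt0Pr => e e0.
have [s Ss si] := inf_adherent (divr_gt0 e0 K1) infS.
apply: (le_trans (phiK (inf S) s)); apply: lerD; first exact: Ss.
rewrite ger0_norm ?subr_ge0 ?ge_inf//.
apply: (@le_trans _ _ ((1 + K) * (e / (1 + K)))); last first.
  by rewrite mulrC divfK// gt_eqF.
apply: ler_pM => //; [by rewrite subr_ge0 ge_inf|by rewrite lerDr|].
by rewrite lerBlDl ltW.
Unshelve. all: by end_near. Qed.

End Extrema.

Section ConditionalValueAtRisk.
Context (d : measure_display) (T : measurableType d) (R : realType).
Variable P : probability T R.
Context (alpha : R).
Hypothesis halpha : 0 < alpha < 1.
Local Notation kappa := (1 - alpha)^-1.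
Implicit Types (X : T -> R).

Lemma kappa_gt1 : 1 < kappa.
Proof. by have /andP[? ?] := halpha; rewrite invf_gt1; lra. Qed.

Lemma cvar_obj_smallest_minimizer X : X \in Lfun P 1 ->
  exists m, is_minimum [set t' | forall t,
    cvar_obj P alpha X t' <= cvar_obj P alpha X t] m.
Proof.
move=> LX; have k1 := kappa_gt1; have k0 : 0 <= kappa by lra.
have LXt t : (fun w => X w - t) \in Lfun P 1 by apply: L1B => //; exact: L1_cst.
have LM t : (fun w => Num.max 0 (X w - t)) \in Lfun P 1.
  by apply: L1_max => //; exact: L1_cst.
have obj_ge1 t : t <= cvar_obj P alpha X t.
  by rewrite lerDl mulr_ge0// mean_ge0// => w; rewrite le_max lexx.
have obj_ge2 t : t + kappa * (mean P X - t) <= cvar_obj P alpha X t.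
  rewrite lerD2l ler_wpM2l// -[t in leLHS](mean_cst P).
  rewrite -meanB//; last exact: L1_cst.
  by apply: mean_le => // w; rewrite le_max lexx orbT.
set phi0 := cvar_obj P alpha X 0.
pose lo := - `|(phi0 - kappa * mean P X) / (kappa - 1)|.
apply: (@smallest_minimizer_exists _ _ (1 + kappa) lo `|phi0|).
- lra.
- by rewrite oppr_le0 !normr_ge0.
- move=> s t; rewrite /cvar_obj.
  have : mean P (fun w => Num.max 0 (X w - s)) <=
      mean P (fun w => Num.max 0 (X w - t) + `|t - s|).
    apply: mean_le => [||w] //; first by apply: L1D => //; exact: L1_cst.
    rewrite ge_max addr_ge0 ?le_max ?lexx//=.
    rewrite (_ : X w - s = (X w - t) + (t - s)); last by ring.
    by rewrite lerD ?ler_norm// le_max lexx orbT.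
  rewrite meanD//; last exact: L1_cst.
  rewrite mean_cst => /(ler_wpM2l k0); rewrite mulrDr.
  by have := ler_norm (s - t); rewrite distrC; lra.
- move=> t tphi; apply/andP; split; last first.
    exact: le_trans (le_trans (obj_ge1 t) tphi) (ler_norm _).
  rewrite /lo lerNl; apply: le_trans (ler_norm _).
  rewrite ler_pdivlMr; last by lra.
  have : t + kappa * (mean P X - t) <= phi0 := le_trans (obj_ge2 t) tphi.
  by move: kappa => k; lra.
Qed.

Lemma VaR_is_minimum X : X \in Lfun P 1 ->
  is_minimum [set t' | forall t,
    cvar_obj P alpha X t' <= cvar_obj P alpha X t] (VaR P alpha X).
Proof.
by move=> /cvar_obj_smallest_minimizer[m mP]; rewrite /VaR (minimumE mP).
Qed.

Lemma CVaR_VaR X : X \in Lfun P 1 ->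
  CVaR P alpha X = cvar_obj P alpha X (VaR P alpha X).
Proof.
move=> /VaR_is_minimum[vmin _]; apply: minimumE.
by split; [exists (VaR P alpha X)|move=> _ [t _ <-]; exact: vmin].
Qed.

(* CVaR(Z) = - O_u(- Z) and VaR(Z) = - m_u(- Z) for this utility u. *)
Definition cvar_utility (t : R) : R := Num.min 0 (kappa * t).

Definition cvar_slope (b : bool) : R := if b then kappa else 0.

Lemma cvar_slope_ge0 b : 0 <= cvar_slope b.
Proof. by case: b => //=; have := kappa_gt1; lra. Qed.

Lemma cvar_utility_le b t : cvar_utility t <= cvar_slope b * t + 0.
Proof.
by rewrite addr0 /cvar_utility; case: b => /=; rewrite ?mul0r ge_min lexx ?orbT.
Qed.

Lemma cvar_utility_attained t : exists b, cvar_utility t = cvar_slope b * t + 0.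
Proof.
rewrite /cvar_utility; have [_|_] := leP 0 (kappa * t).
  by exists false; rewrite /= mul0r addr0.
by exists true; rewrite addr0.
Qed.

Lemma cvar_objE X t : X \in Lfun P 1 ->
  cvar_obj P alpha X t = - oce_real P cvar_utility (fun w => - X w) (- t).
Proof.
move=> LX; rewrite /oce_real /cvar_obj opprD opprK -meanN; last first.
  exact: (L1_pl cvar_slope_ge0 cvar_utility_le cvar_utility_attained
    (L1D (L1N LX) (L1_cst P t))).
rewrite -meanZ; last first.
  by apply: L1_max; [exact: L1_cst|apply: L1B => //; exact: L1_cst].
congr (_ + mean _ _); apply/funext => w; rewrite /cvar_utility.
have k0 : 0 <= kappa by have := kappa_gt1; lra.
rewrite maxr_pMr// mulr0 oppr_min oppr0.
by congr Num.max; ring.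
Qed.

Context (n : nat) (D : set 'rV[R]_n) (p q : 'rV[R]_n -> T -> R).
Hypothesis cD : cvx_set D.
Hypothesis cp : forall w, cvx D (p ^~ w).
Hypothesis cq : forall w, cvx D (q ^~ w).
Hypothesis Lp : forall x, D x -> p x \in Lfun P 1.
Hypothesis Lq : forall x, D x -> q x \in Lfun P 1.
Local Notation Z := (fun x w => p x w - q x w).

Lemma cvar_obj_difference x t : D x -> cvar_obj P alpha (Z x) t =
  - oce_real P cvar_utility (fun w => q x w - p x w) (- t).
Proof.
move=> Dx; rewrite cvar_objE; last exact: (L1_difference Lp Lq Dx).
by congr (- oce_real _ _ _ _); apply/funext => w; rewrite opprB.
Qed.

Lemma dc_CVaR : dc_on D (fun x => CVaR P alpha (Z x)).
Proof.
have LZ x : D x -> Z x \in Lfun P 1 by exact: (L1_difference Lp Lq).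
have oce_le x eta : D x ->
    oce_real P cvar_utility (fun w => q x w - p x w) eta <= - CVaR P alpha (Z x).
  move=> Dx; rewrite CVaR_VaR ?LZ// lerNr -[eta]opprK -cvar_obj_difference//.
  by have [+ _] := VaR_is_minimum (LZ _ Dx); apply.
apply: (@dc_eq _ _ _ _
    (fun x => - sup (range (oce_real P cvar_utility (fun w => q x w - p x w))))).
  move=> x Dx; rewrite -[LHS]opprK; congr (- _); apply/le_anti/andP; split.
    apply: ub_le_sup.
      by exists (- CVaR P alpha (Z x)) => _ [eta _ <-]; exact: oce_le.
    exists (- VaR P alpha (Z x)) => //.
    by rewrite CVaR_VaR ?LZ// cvar_obj_difference// opprK.
  apply: sup_le_ub; first by eexists; exists 0.
  by move=> _ [eta _ <-]; exact: oce_le.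
apply: dcN; apply: (dc_sup_oce cvar_slope_ge0 cvar_utility_le
  cvar_utility_attained) => // x Dx.
by exists (- CVaR P alpha (Z x)) => _ [eta _ <-]; exact: oce_le.
Qed.

Lemma dc_VaR : finite_discrete T -> dc_on D (fun x => VaR P alpha (Z x)).
Proof.
move=> fT; apply: (@dc_eq _ _ _ _ (fun x => - - VaR P alpha (Z x))).
  by move=> x _; rewrite opprK.
apply: dcN.
have [sl slP] := pl_slope cvar_utility_attained.
apply: (dc_largest_maximizer (P := P) cvar_utility_le cvar_utility_attained
  cD cq cp
  (fun t => (slP t).1) (fun t => (slP t).2) fT).
move=> x Dx; have [vmin vlb] := VaR_is_minimum (L1_difference Lp Lq Dx).
split=> [eta|eta etamax].
  by have := vmin (- eta); rewrite !cvar_obj_difference// opprK lerN2.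
rewrite lerNr; apply: vlb => t; rewrite !cvar_obj_difference// lerN2 opprK.
exact: etamax.
Qed.

End ConditionalValueAtRisk.

Section PiecewiseLinearUtility.
Context (d : measure_display) (T : measurableType d) (R : realType).
Variable P : probability T R.
Context (u : R -> \bar R).
Implicit Types (X : T -> R).

Lemma piecewise_linearP : piecewise_linear u ->
  exists (I : nat) (a c : 'I_I -> R) (v : R -> R),
    [/\ forall i, 0 <= a i, forall i t, v t <= a i * t + c i,
        forall t, exists i, v t = a i * t + c i & forall t, u t = (v t)%:E].
Proof.
move=> [I [a [c [I0 a0 uE]]]].
have uatt t : exists i, u t = (a i * t + c i)%:E.
  rewrite uE; have [i _ ->] := @eq_bigmin _ _ _ +oo%E (Ordinal I0) xpredT
    (fun i => (a i * t + c i)%:E) isT (fun i _ => leey _).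
  by exists i.
have uv t : u t = (fine (u t))%:E by have [i ->] := uatt t.
exists I, a, c, (fun t => fine (u t)); split=> // [i t|t].
  by rewrite -lee_fin -uv uE; exact: bigmin_le.
by have [i ui] := uatt t; exists i; rewrite ui.
Qed.

Context (v : R -> R).
Hypothesis uE : forall t, u t = (v t)%:E.

Lemma oce_objE X eta : (fun w => v (X w - eta)) \in Lfun P 1 ->
  oce_obj P u X eta = (oce_real P v X eta)%:E.
Proof.
move=> Lv; rewrite /oce_obj /oce_real EFinD; congr (_ + _)%E.
rewrite /mean fineK ?expectation_fin_num// unlock.
by apply: eq_integral => w _; rewrite uE.
Qed.

Lemma OCEE X : (forall eta, (fun w => v (X w - eta)) \in Lfun P 1) ->
  has_ubound (range (oce_real P v X)) ->
  OCE P u X = (sup (range (oce_real P v X)))%:E.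
Proof.
move=> Lv ubX; rewrite /OCE -ereal_sup_EFin//; last by eexists; exists 0.
congr ereal_sup; rewrite image_comp; apply/eq_imagel => eta _ /=.
exact: oce_objE.
Qed.

Lemma oce_argmaxE X : (forall eta, (fun w => v (X w - eta)) \in Lfun P 1) ->
  oce_argmax P u X = oce_real_argmax P v X.
Proof.
move=> Lv; apply/seteqP; split=> m mP eta; have := mP eta;
  by rewrite !oce_objE// lee_fin.
Qed.

Lemma oce_real_ubound X : concave_subgradient u 0 1 -> u 0 = 0%E ->
  X \in Lfun P 1 -> (forall eta, (fun w => v (X w - eta)) \in Lfun P 1) ->
  has_ubound (range (oce_real P v X)).
Proof.
move=> su u0 LX Lv; exists (mean P X) => _ [eta _ <-].
have vt t : v t <= t.
  by have := su t; rewrite u0 uE add0e subr0 mul1r lee_fin.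
rewrite -lerBrDl -[eta in leRHS](mean_cst P) -meanB//; last exact: L1_cst.
by apply: mean_le => //; apply: L1B => //; exact: L1_cst.
Qed.

End PiecewiseLinearUtility.

Lemma dc_risk (R : realType) (n : nat) (D : set 'rV[R]_n)
    (d : measure_display) (T : measurableType d) (P : probability T R) (lam : R)
    (Dev : (T -> R) -> R) (Z : 'rV[R]_n -> T -> R) :
  dc_on D (fun x => mean P (Z x)) -> dc_on D (fun x => Dev (Z x)) ->
  dc_on D (fun x => risk P lam Dev (Z x)).
Proof. by move=> dZ dDev; apply: dcD => //; exact: dcZ. Qed.

Theorem mainTheorem4 (R : realType) (n : nat) (D : set 'rV[R]_n)
    (d : measure_display) (T : measurableType d) (P : probability T R)
    (lam alpha : R) (p q : 'rV[R]_n -> T -> R)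
    (hD : @convex_set R 'rV[R]_n D)
    (hlam : 0 < lam) (halpha : 0 < alpha < 1)
    (hp : forall w, @convex_function R 'rV[R]_n D (fun x => p x w))
    (hq : forall w, @convex_function R 'rV[R]_n D (fun x => q x w))
    (ip : forall x, D x -> p x \in Lfun P 1)
    (iq : forall x, D x -> q x \in Lfun P 1) :
  let Z := fun (x : 'rV[R]_n) (w : T) => p x w - q x w in
  (forall B : (T -> R) -> R,
    [\/ B = mean P, B = CVaR P alpha |
        B = VaR P alpha /\ finite_discrete T] ->
    [/\ (forall x, D x -> p x \in Lfun P 2%:E /\ q x \in Lfun P 2%:E) ->
          dc_on D (fun x => risk P lam (fun Y => sq_dev P (B Y) Y) (Z x)),
        finite_discrete T ->
          dc_on D (fun x => risk P lam (fun Y => root_dev P (B Y) Y) (Z x)),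
        dc_on D (fun x => risk P lam (fun Y => plus_dev P (B Y) Y) (Z x)) &
        dc_on D (fun x => risk P lam (fun Y => abs_dev P (B Y) Y) (Z x))]) /\
  dc_on D (fun x => risk P lam (CVaR P alpha) (Z x)) /\
  (finite_discrete T ->
    dc_on D (fun x => risk P lam (VaR P alpha) (Z x))) /\
  (forall u : R -> \bar R, utility u -> piecewise_linear u ->
    [/\ (forall x, D x -> OCE P u (Z x) \is a fin_num),
        dc_on D (fun x => fine (OCE P u (Z x))) &
        finite_discrete T ->
        (forall x, D x -> exists m, is_maximum (oce_argmax P u (Z x)) m) ->
          dc_on D (fun x => largest_maximizer P u (Z x))]).
Proof.
move/convex_setP in hD.
have cp w : cvx D (p ^~ w) by apply/convex_functionP; exact: hp.
have cq w : cvx D (q ^~ w) by apply/convex_functionP; exact: hq.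
move=> Z.
have LZ x : D x -> Z x \in Lfun P 1 by exact: (L1_difference ip iq).
have dZ : dc_on D (fun x => mean P (Z x)) by exact: dc_mean.
split=> [B hB|].
  have dB : dc_on D (fun x => B (Z x)).
    case: hB => [->|->|[-> fT]]; first exact: dZ.
    - exact: dc_CVaR.
    - exact: dc_VaR.
  split.
  - move=> L2; apply: dc_risk => //; apply: dc_sq_dev => // x /L2[? ?];
      exact: sqint_Lfun2.
  - move=> fT; apply: dc_risk => //; move/dc_onP: dB => [b1 [b2 [cb1 cb2 bE]]].
    apply: (@dc_eq _ _ _ _
        (fun x => rms P (fun w => (p x w + b2 x) - (q x w + b1 x)))).
      move=> x Dx; rewrite /root_dev bE//; congr (Num.sqrt (mean _ _)).
      by apply/funext => w; rewrite /Z; ring.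
    by apply: dc_rms => // w; exact: cvxD.
  - by apply: dc_risk => //; exact: dc_plus_dev.
  - by apply: dc_risk => //; exact: dc_abs_dev.
split; first by apply: dc_risk => //; exact: dc_CVaR.
split; first by move=> fT; apply: dc_risk => //; exact: dc_VaR.
move=> u [_ _ _ _ [_ u0 su]] /piecewise_linearP[I [a [c [v [a0 vle vatt uE]]]]].
have Lv x eta : D x -> (fun w => v (Z x w - eta)) \in Lfun P 1.
  by move=> /LZ; exact: (L1_pl_shift a0 vle vatt).
have ubZ x : D x -> has_ubound (range (oce_real P v (Z x))).
  move=> Dx; apply: (oce_real_ubound uE) => //; first exact: LZ.
  by move=> eta; exact: Lv.
have OE x : D x -> OCE P u (Z x) = (sup (range (oce_real P v (Z x))))%:E.
  by move=> Dx; apply: OCEE => // [eta|]; [exact: Lv|exact: ubZ].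
split=> [x /OE->//||fT mex].
  apply: (@dc_eq _ _ _ _ (fun x => sup (range (oce_real P v (Z x))))).
    by move=> x /OE->.
  exact: (dc_sup_oce a0 vle vatt).
have [sl slP] := pl_slope vatt.
apply: (dc_largest_maximizer (P := P) vle vatt hD cp cq
  (fun t => (slP t).1) (fun t => (slP t).2) fT) => x Dx.
have [m mP] := mex x Dx.
rewrite -(oce_argmaxE uE); last by move=> eta; exact: Lv.
by rewrite /largest_maximizer (maximumE mP).
Qed.
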